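(* For any prime number $p\ge 2$ and integer $s\ge 0$, there exists a self-dual regular $3$-polytope with Schläfli type $\{2^s p,2^s p\}$ possessing precisely $2^{(2^s p+s)}p$ flags.
   Context: An abstract polytope of rank $d$ (a $d$-polytope) is a partially ordered set $\mathcal{P}$ with a strictly order-preserving rank function $\mathrm{rank}:\mathcal{P}\to\{-1,0,\ldots,d\}$ such that: (i) $\mathcal{P}$ has a unique minimal element $F_{-1}$ (of rank $-1$) and a unique maximal element $F_d$ (of rank $d$); (ii) every maximal totally ordered subset (called a flag) contains exactly $d+2$ elements, including $F_{-1}$ and $F_d$; (iii) (diamond condition) whenever $F<G$ in $\mathcal{P}$ with $\mathrm{rank}(G)-\mathrm{rank}(F)=2$, there are exactly two elements $H$ with $F<H<G$; (iv) (strong connectivity) any two flags $\Phi,\Psi$ can be joined by a sequence of flags $\Phi=\Phi_0,\Phi_1,\ldots,\Phi_k=\Psi$ such that consecutive flags differ in exactly one element and every $\Phi_i$ contains $\Phi\cap\Psi$. An element of rank $i$ is called an $i$-face. An automorphism of $\mathcal{P}$ is an order-preserving bijection $\mathcal{P}\to\mathcal{P}$ that preserves the partial order structure (its inverse is also order-preserving) and the ranks; the group of automorphisms is $\mathrm{Aut}(\mathcal{P})$. The polytope $\mathcal{P}$ is regular if $\mathrm{Aut}(\mathcal{P})$ acts transitively on flags. For a regular $d$-polytope with a fixed base flag $\Phi$, let $\rho_i\in\mathrm{Aut}(\mathcal{P})$ ($0\le i\le d-1$) be the automorphism mapping $\Phi$ to the unique flag differing from $\Phi$ exactly in the $i$-face;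 the (Schläfli) type of $\mathcal{P}$ is $\{p_1,\ldots,p_{d-1}\}$, where $p_i$ is the order of $\rho_{i-1}\rho_i$. The dual $\mathcal{P}^*$ is obtained from $\mathcal{P}$ by reversing the partial order, and $\mathcal{P}$ is self-dual if $\mathcal{P}\cong\mathcal{P}^*$. *)

(* Defs.v *)
From HB Require Import structures.
From mathcomp Require Import all_boot all_order all_algebra all_fingroup.

Set Implicit Arguments.
Unset Strict Implicit.
Unset Printing Implicit Defensive.

Import Order.TTheory GRing.Theory Num.Theory.

(* Every face of a polytope lies in a flag, and flags are finite, so a polytope
   with finitely many flags has finitely many faces; this is the case of
   interest here, so faces are taken in a finite partially ordered type. *)

Section RankedPoset.
Context {disp : Order.disp_t} {P : finPOrderType disp}.
Implicit Types (x y F G H : P) (C X Y Phi Psi : {set P}) (rk : P -> int).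

Definition minimal F : Prop := forall x, (x <= F)%O -> x = F.
Definition maximal F : Prop := forall x, (F <= x)%O -> x = F.

Definition chain C : bool := [forall x in C, forall y in C, (x >=< y)%O].

Definition flags : {set {set P}} := [set C | maxset chain C].

Definition adjacent X Y : bool := (#|X :\: Y| == 1) && (#|Y :\: X| == 1).

Record is_polytope (d : nat) rk : Prop := IsPolytope {
  polytope_rank_range : forall x, (-1 <= rk x <= d%:Z)%R;
  polytope_rank_lt : forall x y, (x < y)%O -> (rk x < rk y)%R;
  polytope_flags : exists Fmin Fmax : P,
    [/\ unique minimal Fmin /\ (rk Fmin = -1)%R,
        unique maximal Fmax /\ (rk Fmax = d%:Z)%R
      & forall Phi, Phi \in flags ->
          [/\ #|Phi| = d.+2, Fmin \in Phi & Fmax \in Phi]];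
  polytope_diamond : forall F G, (F < G)%O -> (rk G - rk F = 2)%R ->
    #|[set H | (F < H < G)%O]| = 2;
  polytope_connected : forall Phi Psi, Phi \in flags -> Psi \in flags ->
    exists s : seq {set P},
      [/\ path adjacent Phi s, last Phi s = Psi
        & {in s, forall X, X \in flags /\ Phi :&: Psi \subset X}]
}.

End RankedPoset.

Arguments flags {disp} P.

Definition is_ranked_embedding {dP dQ : Order.disp_t}
    {P : finPOrderType dP} {Q : finPOrderType dQ}
    (rkP : P -> int) (rkQ : Q -> int) (f : P -> Q) : bool :=
  [forall x, forall y, (f x <= f y)%O == (x <= y)%O]
  && [forall x, rkQ (f x) == rkP x].

Definition isomorphic {dP dQ : Order.disp_t}
    {P : finPOrderType dP} {Q : finPOrderType dQ}
    (rkP : P -> int) (rkQ : Q -> int) : Prop :=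
  exists f : P -> Q, bijective f /\ is_ranked_embedding rkP rkQ f.

Definition dual_rank {disp : Order.disp_t} {P : finPOrderType disp}
    (d : nat) (rk : P -> int) : P^d%type -> int :=
  fun x => (d%:Z - 1 - rk x)%R.

Section Symmetry.
Context {disp : Order.disp_t} {P : finPOrderType disp}.
Implicit Types (Phi Psi : {set P}) (rk : P -> int).

Definition self_dual (d : nat) rk : Prop := isomorphic rk (dual_rank d rk).

Definition polytope_aut rk : {set {perm P}} :=
  [set f : {perm P} | is_ranked_embedding rk rk f].

Lemma polytope_aut_group_set rk : group_set (polytope_aut rk).
Proof.
apply/group_setP; split=> [|f g]; rewrite !inE.
  by apply/andP; split; apply/forallP=> x; [apply/forallP=> y|]; rewrite !perm1.
case/andP=> /'forall_forallP fO /'forall_eqP fR.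
case/andP=> /'forall_forallP gO /'forall_eqP gR.
apply/andP; split; apply/forallP=> x; [apply/forallP=> y|]; rewrite !permM.
  by rewrite (eqP (gO _ _)) fO.
by rewrite gR fR.
Qed.

Canonical polytope_aut_group rk := Group (polytope_aut_group_set rk).

Definition is_regular rk : bool :=
  [transitive polytope_aut rk, on flags P | 'P^*].

(* [Phi] and [Psi] are distinct and differ exactly in their faces of rank i. *)
Definition rank_adjacent rk (i : nat) Phi Psi : Prop :=
  Phi <> Psi /\ forall x, (rk x <> i%:Z)%R -> (x \in Phi) = (x \in Psi).

Definition is_base_reflection rk Phi (i : nat) (rho : {perm P}) : Prop :=
  [/\ rho \in polytope_aut rk, rho @: Phi \in flags P
    & rank_adjacent rk i Phi (rho @: Phi)].

(* The j-th entry of [ps], counted from 0, is the order of rho_j rho_(j+1).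
   For a regular polytope the rho_i are determined by the base flag [Phi], and
   the orders do not depend on [Phi]. *)
Definition has_schlafli_type (d : nat) rk (ps : seq nat) : Prop :=
  forall Phi, Phi \in flags P ->
    exists rho : nat -> {perm P},
      (forall i, i < d -> is_base_reflection rk Phi i (rho i)) /\
      ps = mkseq (fun j => #[rho j * rho j.+1]%g) d.-1.

End Symmetry.

(* Main.v *)
From HB Require Import structures.
Require Import Defs.
From mathcomp Require Import all_boot all_order all_algebra all_fingroup.
From mathcomp Require Import cyclic ring.

(** Put m = 2^s p, so that m >= 2 and the required number of flags is m 2^m.
The polytope is obtained by halving the regular polytope of type {4, m} whose
vertices are the binary vectors of length m, two of them being joined when they
differ in one coordinate, and whose polygons are the squares in the directions
{i, i + 1}, for i in Z/m.  As every side of a square joins an even vector to an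
odd one, the even vectors can be taken as the vertices of a new polytope, the
odd vectors as its 2-faces and the squares as its edges, with incidence given
by membership of a common square.

Everything asked for can be read off from this description.  A flag is a
square together with one of its four sides: there are m 2^(m-2) squares, hence
m 2^m flags.  The translations of the cube and the dihedral moves j |-> c + j
and j |-> c - j of the coordinates respect the squares.  Those that preserve
parity are automorphisms, and they already act transitively on the flags
(lemma [motion_base_flag]); translation by a unit vector exchanges the even and
the odd vectors, which is self-duality (lemma [face_self_dual]).  The last two
base reflections are reflections of the coordinates and their product is the
cyclic rotation of the coordinates, of order m (lemma [order_rotation]);
translation by a unit vector conjugates the first reflection to the last one
and fixes the middle one, so the other product has the same order.

Strong connectivity (lemma [flags_connected]) combines two facts: the flags
through a given corner form a single cycle, because Z/m is generated by 1
(lemma [connect_around]), and a flag through a corner is also a flag through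
one of its neighbours, so that one can walk along the cube
(lemma [connect_all]). *)

(** * Flags, reflections and automorphisms of a finite ranked poset *)

Section RegularPolytopes.

Set Implicit Arguments.
Unset Strict Implicit.
Unset Printing Implicit Defensive.

Context {disp : Order.disp_t} {P : finPOrderType disp}.
Implicit Types (rk : P -> int) (C Phi Psi : {set P}) (f g rho : {perm P}).

Lemma polytope_autP rk f : reflect
  ((forall x y, (f x <= f y)%O = (x <= y)%O) /\ (forall x, rk (f x) = rk x))
  (f \in polytope_aut rk).
Proof.
rewrite inE; apply: (iffP andP) => [[/forallP fO /forallP fR] | [fO fR]].
  split=> [x y | x]; last exact/eqP.
  by have /forallP/(_ y)/eqP := fO x.
split; last by apply/forallP=> x; apply/eqP.
by apply/forallP=> x; apply/forallP=> y; apply/eqP.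
Qed.

Lemma aut_chain rk f C : f \in polytope_aut rk -> chain C -> chain (f @: C).
Proof.
move=> /polytope_autP[fO _] /forall_inP cC.
apply/forall_inP=> _ /imsetP[x xC ->]; apply/forall_inP=> _ /imsetP[y yC ->].
have /forall_inP/(_ y yC) := cC x xC.
by rewrite /Order.comparable !fO.
Qed.

Lemma imset_permK f C : f^-1%g @: (f @: C) = C.
Proof.
rewrite -imset_comp -[RHS]imset_id; apply: eq_imset => x /=.
by rewrite permK.
Qed.

Lemma imset_permKV f C : f @: (f^-1%g @: C) = C.
Proof. by rewrite -{1}[f]invgK imset_permK. Qed.

Lemma aut_flag rk f C : f \in polytope_aut rk -> C \in flags P -> f @: C \in flags P.
Proof.
move=> fA; rewrite !inE => /maxsetP[cC maxC]; apply/maxsetP.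
split=> [|D cD sCD]; first exact: aut_chain fA cC.
rewrite -(imset_permKV f D) (maxC (f^-1%g @: D)) //.
  by apply: (@aut_chain rk) => //; rewrite groupV.
by rewrite -(imset_permK f C); apply: imsetS.
Qed.

(** Regularity needs only that a single flag can be sent to all others. *)
Lemma regular_of_base rk Phi : Phi \in flags P ->
  (forall Psi, Psi \in flags P -> exists2 g, g \in polytope_aut rk & g @: Phi = Psi) ->
  is_regular rk.
Proof.
move=> PhiF tr; apply/imsetP; exists Phi => //; apply/setP=> Psi.
apply/idP/orbitP=> [/tr[g gA <-] | [g gA <-]].
  by exists g => //; rewrite /= setactE.
by rewrite /= setactE; apply: aut_flag gA PhiF.
Qed.

Lemma base_reflectionJ rk Phi i rho g : g \in polytope_aut rk ->
  is_base_reflection rk Phi i rho ->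
  is_base_reflection rk (g @: Phi) i (rho ^ g)%g.
Proof.
move=> gA [rhoA rhoPhi [nPhi adj]].
have E : (rho ^ g)%g @: (g @: Phi) = g @: (rho @: Phi).
  by rewrite -!imset_comp; apply: eq_imset => x /=; rewrite permJ.
split; rewrite ?E ?groupJ //; first exact: aut_flag gA rhoPhi.
split=> [/(imset_inj perm_inj)//|x rx].
have [_ gR] := polytope_autP _ _ gA.
rewrite -(permKV g x) !(mem_imset _ _ perm_inj); apply: adj.
by rewrite -gR permKV.
Qed.

(** By regularity the reflections at any other flag are conjugates of those at
[Phi], and conjugation preserves the orders of their products. *)
Lemma schlafli_type_of_base d rk Phi (rho : nat -> {perm P}) :
  is_regular rk -> Phi \in flags P ->
  (forall i, i < d -> is_base_reflection rk Phi i (rho i)) ->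
  has_schlafli_type d rk (mkseq (fun j => #[rho j * rho j.+1]%g) d.-1).
Proof.
move=> reg PhiF refl Psi PsiF.
have [g gA] := atransP2 reg PhiF PsiF; rewrite /= setactE => ->.
exists (fun i => rho i ^ g)%g; split=> [i id|].
  exact: base_reflectionJ gA (refl i id).
by apply: eq_map => j; rewrite -conjMg orderJ.
Qed.

End RegularPolytopes.

(** * Squares of the binary cube *)

Section Faces.

Set Implicit Arguments.
Unset Strict Implicit.
Unset Printing Implicit Defensive.

Local Open Scope ring_scope.
Import Order.TTheory GRing.Theory Num.Theory.

(* The cube has k.+2 coordinates, which makes their index type a ring Z/m with
   m >= 2. *)
Variable k : nat.

Local Notation Z := 'I_k.+2.
Local Notation W := {ffun Z -> bool}.

Implicit Types (i j l c : Z) (v w x y t : W) (b : bool).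

Definition unit_vec j : W := [ffun l => l == j].

Definition parity x : bool := \sum_j x j.

(** The square through [x] in the directions [i] and [i + 1] is a coset of the
span of two unit vectors; it is represented by its element that vanishes in
these two directions. *)
Definition square i x : W := [ffun l => [&& l != i, l != i + 1 & x l]].

Lemma addxx x : x + x = 0.
Proof. by apply/ffunP=> l; rewrite !ffunE; case: (x l). Qed.

Lemma addKx x y : x + (x + y) = y.
Proof. by rewrite addrA addxx add0r. Qed.

Lemma addxK x y : x + y + y = x.
Proof. by rewrite -addrA addxx addr0. Qed.

Lemma neq_succ i : (i == i + 1) = false.
Proof. by rewrite -subr_eq0 opprD addNKr oppr_eq0. Qed.

Lemma parityD x y : parity (x + y) = parity x (+) parity y.
Proof.
by rewrite /parity -big_split; apply: eq_bigr => j _; rewrite ffunE.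
Qed.

Lemma parity_unit j : parity (unit_vec j) = true.
Proof.
rewrite /parity (bigD1 j) //= big1 => [|l /negPf nlj]; rewrite ffunE ?eqxx //.
Qed.

Lemma unit_vec_inj : injective unit_vec.
Proof. by move=> i j /ffunP/(_ i); rewrite !ffunE eqxx => /esym/eqP. Qed.

Lemma parity0 : parity 0 = false.
Proof. by rewrite /parity big1 // => j _; rewrite ffunE. Qed.

Lemma square_idem i x : square i (square i x) = square i x.
Proof. by apply/ffunP=> l; rewrite !ffunE; case: eqP; case: eqP. Qed.

Lemma squareD i x y : square i (x + y) = square i x + square i y.
Proof. by apply/ffunP=> l; rewrite !ffunE; case: eqP; case: eqP. Qed.

Lemma square_unit i : square i (unit_vec i) = 0.
Proof. by apply/ffunP=> l; rewrite !ffunE; case: eqP => //= _; rewrite andbF. Qed.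

Lemma square_unit1 i : square i (unit_vec (i + 1)) = 0.
Proof. by apply/ffunP=> l; rewrite !ffunE; case: eqP; case: eqP. Qed.

Lemma square_eq0 i x : square i x = 0 ->
  x = (if x i then unit_vec i else 0) + (if x (i + 1) then unit_vec (i + 1) else 0).
Proof.
move=> sx0; apply/ffunP=> l; rewrite ffunE (fun_if (fun f : W => f l)).
rewrite [X in _ = _ + X](fun_if (fun f : W => f l)) !ffunE.
have /ffunP/(_ l) := sx0; rewrite !ffunE.
have [-> _|_] := eqVneq l i; first by rewrite neq_succ if_same addr0; case: (x i).
have [-> _|_ /= ->] := eqVneq l (i + 1); first by rewrite if_same; case: (x _).
by rewrite !if_same.
Qed.

Lemma eq_square i x y :
  (square i x == square i y) = (square i (x + y) == 0).
Proof.
rewrite squareD; apply/eqP/eqP=> [->|E]; first exact: addxx.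
by rewrite -[LHS](addxK _ (square i y)) E add0r.
Qed.

Lemma addx_eq x y t : (x + y == t) = (y == x + t).
Proof. by apply/eqP/eqP=> [<-|->]; rewrite addKx. Qed.

Lemma eq_addx x y t : x = y + t -> t = x + y.
Proof. by move=> ->; rewrite addrC addKx. Qed.

(** The square through [x] consists of [x], its two neighbours in the directions
[i] and [i + 1], and the opposite corner: parity separates the neighbours from
the other two. *)
Lemma square_opp i x y : parity x != parity y ->
  (square i x == square i y) =
  (y == x + unit_vec i) || (y == x + unit_vec (i + 1)).
Proof.
move=> pxy; rewrite eq_square -!addx_eq.
have {pxy}: parity (x + y) by rewrite parityD; case: (parity x) (parity y) pxy => [] [].
move: (x + y) => t pt; apply/eqP/orP=> [/square_eq0 E | [] /eqP ->]; last first.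
- exact: square_unit1.
- exact: square_unit.
move: pt; rewrite E; case: (t i); case: (t (i + 1)); rewrite ?addr0 ?add0r.
- by rewrite parityD !parity_unit.
- by left.
- by right.
- by rewrite parity0.
Qed.

Lemma square_same i x y : parity x = parity y ->
  (square i x == square i y) =
  (y == x) || (y == x + (unit_vec i + unit_vec (i + 1))).
Proof.
move=> pxy; rewrite eq_square -addx_eq -[X in (y == X) || _]addr0 -addx_eq.
have {pxy}: ~~ parity (x + y) by rewrite parityD pxy addbb.
move: (x + y) => t pt; apply/eqP/orP=> [/square_eq0 E | [] /eqP ->]; last first.
- by rewrite squareD square_unit square_unit1 addr0.
- by apply/ffunP=> l; rewrite !ffunE !andbF.
move: pt; rewrite E; case: (t i); case: (t (i + 1)); rewrite ?addr0 ?add0r.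
- by right.
- by rewrite parity_unit.
- by rewrite parity_unit.
- by left.
Qed.

(** * The poset of faces *)

(** The direction is part of an edge, because in dimension 2 the two directions
give the same set of four corners but must give two edges. *)
Record edge := MkEdge { edge_val : Z * W;
  _ : square edge_val.1 edge_val.2 == edge_val.2 }.

HB.instance Definition _ := [isSub for edge_val].
HB.instance Definition _ := [Finite of edge by <:].

Lemma edge_subproof i x : square i (square i x) == square i x.
Proof. by rewrite square_idem. Qed.

Definition edge_at i x : edge := @MkEdge (i, square i x) (edge_subproof i x).

Lemma edge_atP (e : edge) : exists i x, e = edge_at i x.
Proof.
case: e => [[i x] ex]; exists i, x; apply/val_inj; rewrite /=.
by rewrite (eqP ex).
Qed.

Lemma eq_edge i j x y :
  (edge_at i x == edge_at j y) = (i == j) && (square i x == square j y).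
Proof. by rewrite -val_eqE. Qed.

Definition on_edge x (e : edge) := square (val e).1 x == (val e).2.

Inductive face := Least | Greatest | Corner of W | Edge of edge.

Definition face_code F : bool + (W + edge) :=
  match F with
  | Least => inl false | Greatest => inl true
  | Corner x => inr (inl x) | Edge e => inr (inr e)
  end.

Definition face_decode (a : bool + (W + edge)) : face :=
  match a with
  | inl b => if b then Greatest else Least
  | inr (inl x) => Corner x | inr (inr e) => Edge e
  end.

Lemma face_codeK : cancel face_code face_decode.
Proof. by case. Qed.

HB.instance Definition _ := Finite.copy face (can_type face_codeK).

Lemma eq_Corner x y : (Corner x == Corner y) = (x == y).
Proof. by apply/eqP/eqP=> [[]|->]. Qed.

Lemma eq_Edge e f : (Edge e == Edge f) = (e == f).
Proof. by apply/eqP/eqP=> [[]|->]. Qed.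

(** Even vectors are the vertices and odd vectors the 2-faces. *)
Definition face_rank F : int :=
  match F with
  | Least => -1
  | Greatest => 3%:Z
  | Corner x => if parity x then 2%:Z else 0
  | Edge _ => 1
  end.

(** Incidence is kept apart from rank: it is symmetric and treats even and odd
corners alike, so that every motion of the cube preserves it, whether or not
the motion exchanges the parities. *)
Definition incident F G : bool :=
  match F, G with
  | Least, _ | _, Least | Greatest, _ | _, Greatest => true
  | Corner x, Corner y => (x == y) ||
      (parity x != parity y) && [exists i, square i x == square i y]
  | Corner x, Edge e | Edge e, Corner x => on_edge x e
  | Edge e, Edge f => e == f
  end.

Definition face_le F G : bool := (face_rank F <= face_rank G)%R && incident F G.

Lemma incident_refl : reflexive incident.
Proof. by case=> //= *; rewrite eqxx. Qed.

Lemma incident_sym : symmetric incident.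
Proof.
case=> [||x|e] [||y|f] //=; rewrite ?[f == e]eq_sym //.
rewrite eq_sym [parity x == _]eq_sym; congr (_ || _ && _).
by apply: eq_existsb => i; rewrite eq_sym.
Qed.

Lemma incident_rank_eq F G : incident F G -> face_rank F = face_rank G -> F = G.
Proof.
case: F G => [||x|e] [||y|f] //=; do ?by case: (parity _).
  by case/orP=> [/eqP -> //|/andP[]]; case: (parity x); case: (parity y).
by move/eqP->.
Qed.

Fact face_le_refl : reflexive face_le.
Proof. by move=> F; rewrite /face_le incident_refl lexx. Qed.

Fact face_le_anti : antisymmetric face_le.
Proof.
move=> F G /andP[/andP[rFG iFG] /andP[rGF _]].
by apply: incident_rank_eq iFG _; apply/eqP; rewrite eq_le rFG.
Qed.

Fact face_le_trans : transitive face_le.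
Proof.
move=> G F H /andP[rFG iFG] /andP[rGH iGH].
rewrite /face_le (le_trans rFG rGH) /=.
have [EFG|nFG] := eqVneq (face_rank F) (face_rank G).
  by rewrite (incident_rank_eq iFG EFG).
have [EGH|nGH] := eqVneq (face_rank G) (face_rank H).
  by rewrite -(incident_rank_eq iGH EGH).
move: nFG nGH rFG iFG rGH iGH.
(* Only an even corner, an edge and an odd corner can follow each other. *)
case: F => [||x|e]; case: H => [||y|f]; case: G => [||z|g] //=;
  do ?[by case: (parity _)]; rewrite ?orbT.
all: try (case px: (parity _); try (case py: (parity _)) => //).
all: try done.
  by case: (parity y).
move=> _ _ _ /eqP ex _ /eqP ey; rewrite orbC; apply/orP; left.
by apply/existsP; exists (val g).1; rewrite ex ey.
Qed.

Fact face_display : Order.disp_t. Proof. exact: Order.Disp. Qed.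

HB.instance Definition _ :=
  Order.Le_isPOrder.Build face_display face face_le_refl face_le_anti face_le_trans.

Lemma face_leE F G : (F <= G)%O = (face_rank F <= face_rank G)%R && incident F G.
Proof. by []. Qed.

Lemma comparable_incident F G : (F >=< G)%O = incident F G.
Proof.
rewrite /Order.comparable !face_leE (incident_sym G F) -andb_orl.
by have := le_total (face_rank F) (face_rank G) => ->.
Qed.

Lemma face_rank_lt F G : (F < G)%O -> face_rank F < face_rank G.
Proof.
rewrite lt_neqAle face_leE => /and3P[nFG rFG iFG]; rewrite lt_neqAle rFG andbT.
by apply: contra nFG => /eqP/(incident_rank_eq iFG)->.
Qed.

Lemma face_ltE F G : (F < G)%O = (face_rank F < face_rank G)%R && incident F G.
Proof.
apply/idP/andP=> [ltFG | [rFG iFG]].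
  by rewrite face_rank_lt // -comparable_incident lt_comparable.
rewrite lt_neqAle face_leE iFG ltW // !andbT.
by apply: contraTneq rFG => ->; rewrite ltxx.
Qed.

End Faces.

Arguments unit_vec_inj {k}.
Arguments Least {k}.
Arguments Greatest {k}.

(** * Flags *)

(** The two corners enter symmetrically, whatever their parities, so that each
argument about flags through a vertex also covers flags through a 2-face.  The
definition is locked because unification would otherwise unfold it to compare
faces. *)
HB.lock Definition flag_of k (v : {ffun 'I_k.+2 -> bool}) (i : 'I_k.+2)
    (x : {ffun 'I_k.+2 -> bool}) : {set face k} :=
  [set F in [:: Least; Greatest; Corner v; Edge (edge_at i v); Corner x]].

Section Flags.

Set Implicit Arguments.
Unset Strict Implicit.
Unset Printing Implicit Defensive.

Local Open Scope ring_scope.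
Import Order.TTheory GRing.Theory Num.Theory.

Variable k : nat.

Local Notation Z := 'I_k.+2.
Local Notation W := {ffun Z -> bool}.

Implicit Types (i j l c : Z) (v w x y t : W) (b : bool).

Local Notation face := (face k).
Local Notation edge := (edge k).

Implicit Types (F G H : face) (e f : edge).

Lemma in_flag_of v i x F : (F \in flag_of v i x) =
  [|| F == Least, F == Greatest, F == Corner v, F == Edge (edge_at i v)
    | F == Corner x].
Proof. by rewrite flag_of.unlock !inE. Qed.

(** [v] and [x] are the ends of a side of a square in the directions [i] and
[i + 1]. *)
Definition side v i x := (parity v != parity x) && (square i v == square i x).

Lemma sideC v i x : side v i x = side x i v.
Proof. by rewrite /side eq_sym [square i v == _]eq_sym. Qed.

Lemma sideE v i x : side v i x = (x == v + unit_vec i) || (x == v + unit_vec (i + 1)).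
Proof.
apply/idP/idP=> [/andP[pvx] | eq_x]; first by rewrite square_opp.
have pvx: parity v != parity x.
  by case/orP: eq_x => /eqP->; rewrite parityD parity_unit; case: parity.
by rewrite /side pvx square_opp.
Qed.

Lemma side_unit v i : side v i (v + unit_vec i).
Proof. by rewrite sideE eqxx. Qed.

Lemma side_unit1 v i : side v i (v + unit_vec (i + 1)).
Proof. by rewrite sideE eqxx orbT. Qed.

Lemma flag_ofC v i x : side v i x -> flag_of v i x = flag_of x i v.
Proof.
case/andP=> _ /eqP E; apply/setP=> F; rewrite !in_flag_of.
have ->: edge_at i v = edge_at i x by apply/eqP; rewrite eq_edge eqxx E eqxx.
by case: (F == Corner v); case: (F == Corner x); rewrite ?orbT.
Qed.

Lemma Least_in_flag_of v i x : Least \in flag_of v i x.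
Proof. by rewrite in_flag_of eqxx ?orbT. Qed.

Lemma Greatest_in_flag_of v i x : Greatest \in flag_of v i x.
Proof. by rewrite in_flag_of eqxx ?orbT. Qed.

Lemma corner_in_flag_of v i x w : (Corner w \in flag_of v i x) = (w == v) || (w == x).
Proof. by rewrite in_flag_of !eq_Corner. Qed.

Lemma edge_in_flag_of v i x e : (Edge e \in flag_of v i x) = (e == edge_at i v).
Proof. by rewrite in_flag_of eq_Edge orbF. Qed.

Lemma on_edge_at x i v : on_edge x (edge_at i v) = (square i x == square i v).
Proof. by []. Qed.

Lemma flag_of_chain v i x : side v i x -> chain (flag_of v i x).
Proof.
case/andP=> pvx svx; apply/forall_inP=> F Fin; apply/forall_inP=> G Gin.
rewrite comparable_incident.
have nb: incident (Corner v) (Corner x).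
  by rewrite /= pvx orbC; apply/orP; left; apply/existsP; exists i.
case: F Fin => [||w|e]; case: G Gin => [||y|f] //.
- rewrite !corner_in_flag_of => /orP[]/eqP-> /orP[]/eqP->;
  rewrite ?incident_refl // incident_sym //.
- rewrite edge_in_flag_of corner_in_flag_of => /eqP-> /orP[]/eqP->;
  by rewrite /= on_edge_at ?eqxx // eq_sym.
- rewrite edge_in_flag_of corner_in_flag_of => /orP[]/eqP-> /eqP->;
  by rewrite /= on_edge_at ?eqxx // eq_sym.
- by rewrite !edge_in_flag_of => /eqP-> /eqP->; rewrite /= eqxx.
Qed.

Lemma chain_incident (C : {set face}) : chain C -> {in C &, forall F G, incident F G}.
Proof.
move=> /forall_inP cC F G FC GC; rewrite -comparable_incident.
by have /forall_inP := cC F FC; apply.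
Qed.

(** Every chain extends to one with an edge: if it has two corners they lie on a
common square, and otherwise any square through its corner will do. *)
Lemma chain_edge (C : {set face}) : chain C ->
  exists e, forall F, F \in C -> incident F (Edge e).
Proof.
move/chain_incident=> cC.
case: (pickP [pred e | Edge e \in C]) => [e eC | noE].
  by exists e => F FC; apply: cC.
case: (pickP [pred x | Corner x \in C]) => [v vC | noC]; last first.
  by exists (edge_at 0 0) => -[||x|e] // FC;
    [have := noC x | have := noE e]; rewrite /= FC.
case: (pickP [pred x | (Corner x \in C) && (parity x != parity v)]) => [x | nox].
  case/andP=> xC pxv; have := cC _ _ xC vC; rewrite /= pxv.
  case/orP=> [/eqP E | /existsP[i /eqP sxv]]; first by rewrite E eqxx in pxv.
  exists (edge_at i v) => -[||w|e] // FC; last by have := noE e; rewrite /= FC.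
  rewrite /= on_edge_at.
  have := cC _ _ FC vC; have := cC _ _ FC xC => /=.
  have [->|_] /= := eqVneq w v; first by rewrite eqxx.
  have [->|_] /= := eqVneq w x; first by rewrite sxv eqxx.
  by move: pxv; case: (parity x); case: (parity v); case: (parity w).
exists (edge_at 0 v) => -[||w|e] // FC; last by have := noE e; rewrite /= FC.
have := cC _ _ FC vC; have := nox w; rewrite /= FC /= => ->.
by rewrite orbF => /eqP->; rewrite on_edge_at eqxx.
Qed.

(** A chain has at most one corner of parity [b]; if it has none, a square that
is incident to all of it provides one. *)
Lemma chain_corner (C : {set face}) i v b : chain C ->
    (forall F, F \in C -> incident F (Edge (edge_at i v))) ->
  exists x, [/\ parity x = b, square i x = square i v &
    forall w, Corner w \in C -> parity w = b -> w = x].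
Proof.
move/chain_incident=> cC Ce.
case: (pickP [pred x | (Corner x \in C) && (parity x == b)]) => [x | nox].
  case/andP=> xC /eqP px; exists x; split=> //; first exact/eqP/(Ce _ xC).
  move=> w wC pw; have := cC _ _ wC xC.
  by rewrite /= pw px eqxx orbF => /eqP.
exists (if parity v == b then v else v + unit_vec i); split.
- by case: eqP => // /eqP; rewrite parityD parity_unit; case: b (parity v) {nox} => [] [].
- by case: eqP; rewrite // squareD square_unit addr0.
- by move=> w wC pw; have := nox w; rewrite /= wC pw eqxx.
Qed.

Lemma chain_sub_flag_of (C : {set face}) : chain C ->
  exists v i x, side v i x /\ C \subset flag_of v i x.
Proof.
move=> cC; have [e Ce] := chain_edge cC; have [i [v Ev]] := edge_atP e; subst e.
have [x [px sx Cx]] := chain_corner true cC Ce.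
have [y [py sy Cy]] := chain_corner false cC Ce.
exists x, i, y; split; first by rewrite /side px py sx sy eqxx.
apply/subsetP=> -[||w|e] FC; rewrite in_flag_of //.
  by rewrite !eq_Corner; case pw: (parity w); [rewrite (Cx w) | rewrite (Cy w)];
    rewrite ?eqxx ?orbT.
have /= /eqP-> := Ce _ FC; rewrite eq_Edge eq_edge eqxx sx eqxx.
by [].
Qed.

Lemma card_flag_of v i x : side v i x -> #|flag_of v i x| = 5.
Proof.
case/andP=> pvx _; rewrite flag_of.unlock cardsE; apply/card_uniqP.
rewrite /= !inE !eq_Corner; do ?[apply/andP; split=> //]; apply/negP.
by move/eqP=> E; rewrite E eqxx in pvx.
Qed.

Lemma flagP (C : {set face}) :
  reflect (exists v i x, side v i x /\ C = flag_of v i x) (C \in flags face).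
Proof.
rewrite inE; apply: (iffP maxsetP) => [[cC maxC] | [v [i [x [g ->]]]]].
  have [v [i [x [g sub]]]] := chain_sub_flag_of cC.
  by exists v, i, x; split=> //; rewrite (maxC _ (flag_of_chain g) sub).
split=> [|D cD sub]; first exact: flag_of_chain.
have [v' [i' [x' [g' sub']]]] := chain_sub_flag_of cD.
apply/eqP; rewrite eq_sym eqEcard sub (card_flag_of g).
by rewrite -(card_flag_of g') subset_leq_card.
Qed.

(** [a] stands for the square in direction [a.2] at the corner [a.1].  Of the two
sides at this corner, an even corner selects the one in direction [a.2] and an
odd corner the other one; so every side of the square is selected by exactly
one of its ends. *)
Definition flag_at (a : W * Z) : {set face} :=
  flag_of a.1 a.2 (a.1 + unit_vec (a.2 + (parity a.1)%:R)).

Lemma flag_of_inj_dir v i x v' i' x' : flag_of v i x = flag_of v' i' x' -> i = i'.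
Proof.
move/setP/(_ (Edge (edge_at i v))); rewrite !edge_in_flag_of eqxx eq_edge.
by case/esym/andP=> /eqP.
Qed.

Lemma flag_at_inj : injective flag_at.
Proof.
move=> [v i] [w j] /= E; have /= Eij := flag_of_inj_dir E; subst j.
have /setP/(_ (Corner v)) := E; rewrite !corner_in_flag_of eqxx /=.
move/esym/orP=> [/eqP->//|/eqP Ev].
have /setP/(_ (Corner w)) := E; rewrite !corner_in_flag_of eqxx /=.
case/orP=> [/eqP->//|/eqP Ew].
have: unit_vec (i + (parity v)%:R) = unit_vec (i + (parity w)%:R).
  by rewrite (eq_addx Ew) (eq_addx Ev) addrC.
move/unit_vec_inj/addrI; rewrite Ev parityD parity_unit addbT.
by case: (parity w) => /eqP; rewrite ?oner_eq0 // eq_sym oner_eq0.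
Qed.

Lemma flag_of_at v i x : side v i x -> exists a, flag_of v i x = flag_at a.
Proof.
move=> g; have := g; rewrite sideE.
have [->|nE] := eqVneq x (v + unit_vec (i + (parity v)%:R)); first by exists (v, i).
move=> eq_x; exists (x, i); rewrite (flag_ofC g) /flag_at /=.
congr flag_of; apply/eqP; rewrite -addx_eq addrC addx_eq.
move: nE eq_x; have ->: parity x = ~~ parity v.
  by have /andP[] := g; case: parity; case: parity.
by case: (parity v); rewrite /= ?addr0 => /negPf->; rewrite ?orbF.
Qed.

Lemma flag_at_flag a : flag_at a \in flags face.
Proof.
apply/flagP; exists a.1, a.2, (a.1 + unit_vec (a.2 + (parity a.1)%:R)); split=> //.
by rewrite sideE; case: (parity a.1); rewrite ?addr0 eqxx ?orbT.
Qed.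

Lemma card_flags : #|flags face| = (2 ^ k.+2 * k.+2)%N.
Proof.
have ->: flags face = [set flag_at a | a in [set: W * Z]].
  apply/setP=> C; apply/idP/imsetP=> [/flagP[v [i [x [g ->]]]] | [a _ ->]].
    by have [a ->] := flag_of_at g; exists a.
  exact: flag_at_flag.
rewrite card_imset; last exact: flag_at_inj.
by rewrite cardsT card_prod card_ffun card_bool card_ord.
Qed.

(** * The polytope axioms *)

Lemma Least_le F : (Least <= F)%O.
Proof. by rewrite face_leE andbT; case: F => //= x; case: parity. Qed.

Lemma le_Greatest F : (F <= Greatest)%O.
Proof.
by rewrite face_leE; case: F => [||x|e] //=; rewrite andbT; case: parity.
Qed.

Lemma unique_Least : unique (@minimal _ face) Least.
Proof.
split=> [F|F minF]; last exact: minF (Least_le F).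
by rewrite face_leE; case: F => //= x; case: parity.
Qed.

Lemma unique_Greatest : unique (@maximal _ face) Greatest.
Proof.
split=> [F|F maxF]; last exact: maxF (le_Greatest F).
by rewrite face_leE; case: F => //= x; case: parity.
Qed.

Lemma card_edge_corners e b :
  #|[set H | if H is Corner w then (parity w == b) && on_edge w e else false]| = 2.
Proof.
have [i [x ->]] := edge_atP e.
have [v [pv ->]] : exists v, parity v = b /\ edge_at i x = edge_at i v.
  have [px|px] := eqVneq (parity x) b; first by exists x.
  exists (x + unit_vec i); split.
    by rewrite parityD parity_unit; case: b (parity x) px => [] [].
  by apply/eqP; rewrite eq_edge eqxx squareD square_unit addr0 eqxx.
have nE: v != v + (unit_vec i + unit_vec (i + 1)).
  rewrite -addx_eq addxx eq_sym addx_eq addr0.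
  by apply/eqP=> /unit_vec_inj/esym/eqP; rewrite neq_succ.
suff ->: [set H | if H is Corner w
      then (parity w == b) && on_edge w (edge_at i v) else false] =
      [set Corner v; Corner (v + (unit_vec i + unit_vec (i + 1)))].
  by rewrite cards2 eq_Corner nE.
apply/setP=> -[||w|f]; rewrite !inE // !eq_Corner on_edge_at.
have [pw|pw] /= := eqVneq (parity w) b.
  by rewrite eq_sym square_same // pv pw.
apply/esym/negP=> /orP[]/eqP Ew; move: pw; rewrite Ew ?parityD ?parity_unit pv.
  by rewrite eqxx.
by rewrite addbb addbF eqxx.
Qed.

Lemma diamond F G : (F < G)%O -> face_rank G - face_rank F = 2 ->
  #|[set H | (F < H < G)%O]| = 2.
Proof.
rewrite face_ltE.
case: F => [||v|e]; case: G => [||x|e'] //=; do ?[by case: parity].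
- move=> _ _; rewrite -(card_edge_corners e' false); congr #|pred_of_set _|.
  apply/setP=> -[||w|f]; rewrite !inE !face_ltE //=.
  by case: (parity w).
- case pv: (parity v); case px: (parity x) => //=.
  rewrite orbC; case: eqP => [Evx|_ /=]; first by move: pv; rewrite Evx px.
  rewrite orbF => /existsP[j Ej] _.
  have [l Ex] : exists l, x = v + unit_vec l.
    move: Ej; rewrite square_opp ?pv ?px // => /orP[]/eqP; first by exists j.
    by exists (j + 1).
  have -> : [set H | (Corner v < H < Corner x)%O] =
      [set Edge (edge_at l v); Edge (edge_at (l - 1) v)].
    apply/setP=> -[||w|f]; rewrite !inE !face_ltE /= ?pv ?px //.
      by case: (parity w); rewrite ?andbF.
    have [i [z ->]] := edge_atP f; rewrite !eq_Edge !eq_edge !on_edge_at.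
    rewrite ![square i z == _]eq_sym.
    apply/andP/idP=> [[/eqP svz /eqP sxz] | ].
      have : x == v + unit_vec i \/ x == v + unit_vec (i + 1).
        by apply/orP; rewrite -square_opp ?pv ?px // svz sxz.
      rewrite Ex !(inj_eq (addrI v)) !(inj_eq unit_vec_inj).
      by case=> /eqP->; rewrite ?addrK eqxx; apply/orP; [left | right]; apply/eqP.
    have := side_unit v l; have := side_unit1 v (l - 1); rewrite subrK -Ex.
    case/andP=> _ /eqP s1 /andP[_ /eqP s2].
    by case/orP=> /andP[/eqP-> /eqP E]; rewrite -?s1 -?s2 E eqxx.
  rewrite cards2 eq_Edge eq_edge; case: eqP => // El.
  by have /eqP := neq_succ (l - 1); rewrite subrK -El eqxx.
- move=> _ _; rewrite -(card_edge_corners e true); congr #|pred_of_set _|.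
  apply/setP=> -[||w|f]; rewrite !inE !face_ltE //=.
  by case: (parity w); case: (on_edge w e).
Qed.

Implicit Types (O X Y : {set face}).

(** One step of a walk among the flags that contain [O]. *)
Definition flag_step O X Y :=
  [&& adjacent X Y, Y \in flags face & O \subset Y].

(** All flags have the same size, so it is enough to bound one of the two
differences. *)
Lemma connect_flag_step O X Y F : X \in flags face -> Y \in flags face ->
  O \subset Y -> X :\: Y \subset [set F] -> connect (flag_step O) X Y.
Proof.
move=> Xf Yf OY XY; have [->|nXY] := eqVneq X Y; first exact: connect0.
apply: connect1; rewrite /flag_step Yf OY !andbT /adjacent.
have cX: #|X| = 5 by have /flagP[v [i [x [g ->]]]] := Xf; apply: card_flag_of.
have cY: #|Y| = 5 by have /flagP[v [i [x [g ->]]]] := Yf; apply: card_flag_of.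
have cD: #|X :\: Y| = #|Y :\: X| by rewrite !cardsD cX cY setIC.
rewrite -cD andbb eqn_leq -{1}(cards1 F) subset_leq_card //= card_gt0.
rewrite setD_eq0; apply: contra nXY => sXY.
by rewrite eqEcard sXY cX cY.
Qed.

Lemma connect_change_corner O v i x x' : side v i x -> side v i x' ->
  O \subset flag_of v i x' ->
  connect (flag_step O) (flag_of v i x) (flag_of v i x').
Proof.
move=> g g' sO; apply: (@connect_flag_step _ _ _ (Corner x)) => //.
- by apply/flagP; exists v, i, x.
- by apply/flagP; exists v, i, x'.
apply/subsetP=> -[||w|e]; rewrite in_set1 in_setD.
- by rewrite Least_in_flag_of.
- by rewrite Greatest_in_flag_of.
- by rewrite !corner_in_flag_of eq_Corner; case: (w == v) => //= /andP[].
by rewrite !edge_in_flag_of andNb.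
Qed.

Lemma connect_change_edge O v i j x : side v i x -> side v j x ->
  O \subset flag_of v j x ->
  connect (flag_step O) (flag_of v i x) (flag_of v j x).
Proof.
move=> g g' sO; apply: (@connect_flag_step _ _ _ (Edge (edge_at i v))) => //.
- by apply/flagP; exists v, i, x.
- by apply/flagP; exists v, j, x.
apply/subsetP=> -[||w|e]; rewrite in_set1 in_setD.
- by rewrite Least_in_flag_of.
- by rewrite Greatest_in_flag_of.
- by rewrite !corner_in_flag_of andNb.
by rewrite !edge_in_flag_of eq_Edge => /andP[].
Qed.

(** Changing the far corner and then the edge turns the square in direction [i]
at [v] into the one in direction [i + 1]; since 1 generates Z/m, repeating this
visits all the flags through [v]. *)
Lemma connect_around O v i x j y : side v i x -> side v j y ->
  O \subset [set Least; Greatest; Corner v] ->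
  connect (flag_step O) (flag_of v i x) (flag_of v j y).
Proof.
move=> gx gy sO.
have sOv l z : O \subset flag_of v l z.
  apply: subset_trans sO _; apply/subsetP=> F; rewrite !inE in_flag_of.
  by case/orP=> [/orP[]|] /eqP->; rewrite ?eqxx ?orbT.
pose f l := flag_of v l (v + unit_vec l).
have fS l : connect (flag_step O) (f l) (f (l + 1)).
  apply: connect_trans (connect_change_corner (side_unit v l) (side_unit1 v l) _) _ => //.
  rewrite -/(f (l + 1)); apply: connect_change_edge => //; first exact: side_unit1.
  exact: side_unit.
have fn l m : connect (flag_step O) (f l) (f (l + m%:R)).
  elim: m => [|m IH]; first by rewrite addr0 connect0.
  by rewrite mulrSr addrA; apply: connect_trans IH (fS _).
apply: connect_trans (connect_change_corner gx (side_unit v i) _) _ => //.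
apply: connect_trans (fn i (j - i : Z)) _; rewrite natr_Zp subrKC.
exact: connect_change_corner (side_unit v j) gy _.
Qed.

Lemma sum_unit_vec t : t = \sum_(j | t j) unit_vec j.
Proof.
apply/ffunP=> l; rewrite sum_ffunE; case tl: (t l).
  rewrite (bigD1 l) //= ffunE eqxx big1 => [|j /andP[_ njl]] //.
  by rewrite ffunE eq_sym (negPf njl).
rewrite big1 // => j tj; rewrite ffunE; apply: contraFF tl => /eqP->.
exact: tj.
Qed.

(** The flag through [z] and its neighbour [z + unit_vec l] belongs both to the
cycle around [z] and to the cycle around the neighbour; as the unit vectors
generate the cube, all the cycles are connected to each other. *)
Lemma connect_all O X Y : X \in flags face -> Y \in flags face ->
  O \subset [set Least; Greatest] -> connect (flag_step O) X Y.
Proof.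
move=> /flagP[v [i [x [gx ->]]]] /flagP[w [j [y [gy ->]]]] sO.
have sOv z : O \subset [set Least; Greatest; Corner z].
  exact: subset_trans sO (subsetUl _ _).
pose f (z : W) := flag_of z 0 (z + unit_vec 0).
have fS z l : connect (flag_step O) (f z) (f (z + unit_vec l)).
  apply: connect_trans (connect_around (side_unit z 0) (side_unit z l) _) _ => //.
  rewrite (flag_ofC (side_unit z l)).
  by apply: connect_around (side_unit _ 0) _ => //; rewrite sideC side_unit.
have ft t : forall z, connect (flag_step O) (f z) (f (z + t)).
  rewrite [t]sum_unit_vec.
  apply: (big_ind (fun t => forall z, connect (flag_step O) (f z) (f (z + t)))) => //.
    by move=> z; rewrite addr0 connect0.
  by move=> a b Ha Hb z; rewrite addrA; apply: connect_trans (Ha z) (Hb _).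
apply: connect_trans (connect_around gx (side_unit v 0) _) _ => //.
apply: connect_trans (ft (v + w) v) _; rewrite addKx.
exact: connect_around (side_unit w 0) gy _.
Qed.

(** Flags with a common corner: either they share the edge or the other corner,
and then one step is enough, or they share nothing else and
[connect_around] applies. *)
Lemma connect_corner v i x j y : side v i x -> side v j y ->
  connect (flag_step (flag_of v i x :&: flag_of v j y)) (flag_of v i x) (flag_of v j y).
Proof.
move=> gx gy.
have [Ex|nx] := eqVneq x y.
  by subst y; apply: connect_change_edge => //; apply: subsetIr.
have [Ei|ni] := eqVneq i j.
  by subst j; apply: connect_change_corner => //; apply: subsetIr.
apply: connect_around => //; apply/subsetP=> -[||w|e].
- by rewrite !inE.
- by rewrite !inE.
- rewrite !in_setU !in_set1 eq_Corner in_setI !corner_in_flag_of.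
  by case: (w == v) => //= /andP[/eqP->]; rewrite (negPf nx).
rewrite in_setI !edge_in_flag_of => /andP[/eqP->].
by rewrite eq_edge (negPf ni).
Qed.

Lemma flags_connected X Y : X \in flags face -> Y \in flags face ->
  connect (flag_step (X :&: Y)) X Y.
Proof.
move=> Xf Yf; have /flagP[v [i [x [gx EX]]]] := Xf.
have /flagP[w [j [y [gy EY]]]] := Yf.
(* The flags are symmetric in their corners, so [v] and [w] can be taken with
   equal parities; then only [v = w] and [x = y] are possible coincidences. *)
wlog pvw: w y gy EY / parity v = parity w.
  have [pvw H | pvw H] := eqVneq (parity v) (parity w); first exact: H gy EY pvw.
  apply: (H y w); rewrite 1?sideC //; first by rewrite EY flag_ofC.
  by have /andP[] := gy; case: parity pvw; case: parity; case: parity.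
have [Evw|nvw] := eqVneq v w.
  by rewrite EX EY Evw; subst v; apply: connect_corner.
have [Exy|nxy] := eqVneq x y.
  rewrite EX EY (flag_ofC gx) (flag_ofC gy); subst x.
  by apply: connect_corner; rewrite sideC.
have pxy: parity x = parity y.
  have /andP[] := gx; have /andP[] := gy; rewrite pvw.
  by case: parity; case: parity; case: parity.
have nvx: v == y = false.
  by apply: contraTF gy => /eqP<-; rewrite /side pvw eqxx.
have nxw: x == w = false.
  by apply: contraTF gx => /eqP->; rewrite /side pvw eqxx.
have nC z : Corner z \in X :&: Y = false.
  rewrite in_setI EX EY !corner_in_flag_of.
  case: eqP => [->|_]; first by rewrite (negPf nvw) nvx.
  by case: eqP => [->|]; rewrite ?(negPf nxy) ?nxw.
have [Ee|ne] := eqVneq (edge_at i v) (edge_at j w); last first.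
  apply: connect_all => //; apply/subsetP=> -[||z|e]; rewrite ?nC ?inE //.
  rewrite EX EY !edge_in_flag_of => /andP[/eqP->].
  by rewrite (negPf ne).
have /eqP := Ee; rewrite eq_edge => /andP[/eqP Eij /eqP svw]; subst j.
(* Only the edge is shared: pass through the flag with the corners [v], [y]. *)
have gvy: side v i y.
  by rewrite /side pvw svw; exact: gy.
have sO: X :&: Y \subset flag_of v i y.
  apply/subsetP=> -[||z|e]; rewrite ?nC ?Least_in_flag_of ?Greatest_in_flag_of //.
  by rewrite in_setI EX !edge_in_flag_of => /andP[].
rewrite {2}EX; apply: connect_trans (connect_change_corner gx gvy sO) _.
rewrite {2}EY (flag_ofC gvy) (flag_ofC gy).
apply: connect_change_corner; rewrite 1?sideC // -(flag_ofC gy) -EY.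
exact: subsetIr.
Qed.

Lemma flag_step_path O X s : path (flag_step O) X s ->
  path adjacent X s /\ {in s, forall Y, Y \in flags face /\ O \subset Y}.
Proof.
elim: s X => //= Y s IH X /andP[/and3P[aXY fY sOY] /IH[pth ins]].
split=> [|U]; first by rewrite aXY.
by rewrite inE => /orP[/eqP->//|/ins].
Qed.

Lemma face_polytope : is_polytope 3 (@face_rank k).
Proof.
split.
- by case=> [||x|e] //=; case: parity.
- exact: face_rank_lt.
- exists Least, Greatest; split.
  + by split; [exact: unique_Least|].
  + by split; [exact: unique_Greatest|].
  move=> X /flagP[v [i [x [g ->]]]].
  by rewrite card_flag_of // Least_in_flag_of Greatest_in_flag_of.
- exact: diamond.
move=> X Y Xf Yf; have /connectP[s /flag_step_path[pth ins] E] := flags_connected Xf Yf.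
by exists s.
Qed.

(** * Motions of the cube *)

(** The motion given by [c], [r] and [t] sends coordinate j to c + j, or to
c - j if [r] holds, and then translates by [t]. *)
Definition move_cube c r t x : W :=
  [ffun j => x (if r then c - j else j - c)] + t.

(** The reflection j |-> c - j sends the pair {i, i + 1} to
{c - 1 - i, c - i}. *)
Definition move_dir c (r : bool) i : Z := if r then c - 1 - i else c + i.

(** A translation of odd parity reverses the ranks, hence must exchange the two
improper faces. *)
Definition move_face c r t F : face :=
  match F with
  | Least => if parity t then Greatest else Least
  | Greatest => if parity t then Least else Greatest
  | Corner x => Corner (move_cube c r t x)
  | Edge e => Edge (edge_at (move_dir c r (val e).1) (move_cube c r t (val e).2))
  end.

Lemma move_cubeD c r t x y :
  move_cube c r t x + move_cube c r t y = move_cube c r 0 (x + y).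
Proof.
apply/ffunP=> j; rewrite !ffunE.
by case: (t j); case: (x _); case: (y _).
Qed.

Lemma move_cube0 c r t : move_cube c r t 0 = t.
Proof. by apply/ffunP=> j; rewrite !ffunE add0r. Qed.

Lemma move_unit c r t j :
  move_cube c r t (unit_vec j) = unit_vec (if r then c - j else c + j) + t.
Proof.
apply/ffunP=> l; rewrite !ffunE; congr (_ + _); case: r.
  by rewrite subr_eq [in RHS]eq_sym subr_eq addrC.
by rewrite subr_eq addrC.
Qed.

Lemma move_cube_inj c r t : injective (move_cube c r t).
Proof.
move=> x y /addIr/ffunP E; apply/ffunP=> j.
have := E (if r then c - j else c + j); rewrite !ffunE; case: r {E}.
  by rewrite subKr.
by rewrite addrAC subrr add0r.
Qed.

Lemma parity_move c r t x : parity (move_cube c r t x) = parity x (+) parity t.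
Proof.
rewrite parityD; congr (_ (+) _).
rewrite /parity [RHS](reindex_inj (h := fun j => if r then c - j else j - c)) /=.
  by apply: eq_bigr => j _; rewrite ffunE.
by case: r => [i j /addrI/oppr_inj | i j /addIr].
Qed.

Lemma square_move0 c r i x :
  square (move_dir c r i) (move_cube c r 0 x) = move_cube c r 0 (square i x).
Proof.
apply/ffunP=> l; rewrite !ffunE !addr0 /move_dir; case: r.
  have flip a : (c - l == a) = (l == c - a).
    by rewrite [RHS]eq_sym !subr_eq addrC.
  rewrite !flip andbCA; congr [&& l != _, l != _ & _]; ring.
by rewrite !subr_eq [i + c]addrC [i + 1 + c]addrC addrA.
Qed.

Lemma square_move c r t i x y :
  (square (move_dir c r i) (move_cube c r t x) ==
   square (move_dir c r i) (move_cube c r t y)) = (square i x == square i y).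
Proof.
rewrite !eq_square move_cubeD square_move0.
by rewrite -[X in _ == X](move_cube0 c r 0) (inj_eq (@move_cube_inj c r 0)).
Qed.

Lemma move_dir_inj c r : injective (move_dir c r).
Proof. by case: r => i j; [move/addrI/oppr_inj | move/addrI]. Qed.

Lemma move_edge_at c r t i x : move_face c r t (Edge (edge_at i x)) =
  Edge (edge_at (move_dir c r i) (move_cube c r t x)).
Proof.
by apply/eqP; rewrite eq_Edge eq_edge eqxx /= square_move square_idem eqxx.
Qed.

Lemma on_edge_move c r t x e f :
  Edge f = move_face c r t (Edge e) -> on_edge (move_cube c r t x) f = on_edge x e.
Proof.
have [i [v ->]] := edge_atP e; rewrite move_edge_at => -[->].
by rewrite !on_edge_at square_move.
Qed.

Lemma move_face_inj c r t : injective (move_face c r t).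
Proof.
case=> [||x|e] [||y|f] //=; do ?by case: (parity t).
  by case=> /move_cube_inj->.
have [i [v ->]] := edge_atP e; have [j [w ->]] := edge_atP f.
have := move_edge_at c r t i v; have := move_edge_at c r t j w.
rewrite /= => -> -> /eqP; rewrite eq_Edge eq_edge (inj_eq (@move_dir_inj c r)).
case/andP=> /eqP-> ; rewrite square_move => /eqP E.
by apply/eqP; rewrite eq_Edge eq_edge E !eqxx.
Qed.

Lemma incident_move c r t F G :
  incident (move_face c r t F) (move_face c r t G) = incident F G.
Proof.
case: F => [||x|e];
  [by rewrite [X in incident X]/=; case: parity; case: (move_face c r t G);
      case: G.. | |].
  case: G => [||y|f]; [by rewrite /=; case: parity.. | |exact: on_edge_move].
  rewrite /= (inj_eq (@move_cube_inj _ _ _)) !parity_move.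
  congr (_ || _ && _); first by case: parity; case: parity; case: parity.
  apply/existsP/existsP=> -[i]; last by exists (move_dir c r i); rewrite square_move.
  have [h _ hK] := injF_bij (@move_dir_inj c r).
  by rewrite -(hK i) square_move; exists (h i).
case: G => [||y|f]; [by rewrite /=; case: parity.. | |].
  by rewrite incident_sym [RHS]incident_sym; exact: on_edge_move.
have [i [v ->]] := edge_atP e; have [j [w ->]] := edge_atP f.
rewrite !move_edge_at /= !eq_edge (inj_eq (@move_dir_inj c r)).
by case: eqP => // ->; rewrite square_move.
Qed.

Lemma rank_move c r t F : face_rank (move_face c r t F) =
  if parity t then 2 - face_rank F else face_rank F.
Proof.
case: F => [||x|e] /=; rewrite ?parity_move; case: (parity t) => //.
  by case: parity.
by rewrite addbF.
Qed.

Lemma move_faceM c1 r1 t1 c2 r2 t2 F :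
  move_face c2 r2 t2 (move_face c1 r1 t1 F) =
  move_face (if r2 then c2 - c1 else c2 + c1) (r1 (+) r2) (move_cube c2 r2 t2 t1) F.
Proof.
have cubeM x : move_cube c2 r2 t2 (move_cube c1 r1 t1 x) =
  move_cube (if r2 then c2 - c1 else c2 + c1) (r1 (+) r2) (move_cube c2 r2 t2 t1) x.
  apply/ffunP=> j; rewrite !ffunE addrA; congr (x _ + _ + _).
  by case: r1; case: r2 => /=; ring.
case: F => [||x|e].
- by rewrite /= parity_move; case: (parity t1); rewrite /=; case: (parity t2).
- by rewrite /= parity_move; case: (parity t1); rewrite /=; case: (parity t2).
- by rewrite /= cubeM.
have [i [v ->]] := edge_atP e.
rewrite -/(move_face c1 r1 t1 _) -/(move_face _ _ _ (Edge _)).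
rewrite !move_edge_at cubeM.
by congr (Edge (edge_at _ _)); rewrite /move_dir {cubeM};
   case: r1; case: r2 => /=; ring.
Qed.

Definition motion c r t : {perm face} := perm (@move_face_inj c r t).

Lemma motionE c r t F : motion c r t F = move_face c r t F.
Proof. exact: permE. Qed.

Lemma motionM c1 r1 t1 c2 r2 t2 :
  (motion c1 r1 t1 * motion c2 r2 t2)%g =
  motion (if r2 then c2 - c1 else c2 + c1) (r1 (+) r2) (move_cube c2 r2 t2 t1).
Proof. by apply/permP=> F; rewrite permM !motionE move_faceM. Qed.

Lemma motion_aut c r t : ~~ parity t -> motion c r t \in polytope_aut (@face_rank k).
Proof.
move=> /negPf pt; have rk F : face_rank (motion c r t F) = face_rank F.
  by rewrite motionE rank_move pt.
apply/polytope_autP; split=> // F G.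
by rewrite !face_leE !rk !motionE incident_move.
Qed.

Lemma motion_flag_of c r t v i x : ~~ parity t ->
  motion c r t @: flag_of v i x =
  flag_of (move_cube c r t v) (move_dir c r i) (move_cube c r t x).
Proof.
move=> /negPf pt.
have flagE a j z : flag_of a j z =
    Least |: (Greatest |: (Corner a |: (Edge (edge_at j a) |: [set Corner z]))).
  by apply/setP=> F; rewrite in_flag_of !inE.
rewrite !flagE !imsetU1 imset_set1 !motionE move_edge_at.
by rewrite /= pt.
Qed.

Let base_flag := flag_of 0 0 (unit_vec (0 : Z)).

Lemma base_flagP : base_flag \in flags face.
Proof.
apply/flagP; exists 0, 0, (unit_vec 0); split=> //.
by rewrite sideE add0r eqxx.
Qed.

(** The base flag has corners 0 and [unit_vec 0].  A translation brings its even
corner to that of the target; the rotation, or reflection, of the coordinates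
is then chosen according to which of the two sides at this corner is wanted. *)
Lemma motion_base_flag Psi : Psi \in flags face ->
  exists2 g, g \in polytope_aut (@face_rank k) & g @: base_flag = Psi.
Proof.
move=> /flagP[v [i [x [g ->]]]]; wlog pv: v x g / ~~ parity v.
  have [pv|pv] := boolP (parity v); last by apply.
  rewrite (flag_ofC g); apply; rewrite 1?sideC //.
  by have /andP[] := g; rewrite pv; case: parity.
have := g; rewrite sideE => /orP[]/eqP->.
  exists (motion i false v); first exact: motion_aut.
  by rewrite motion_flag_of // move_cube0 move_unit /move_dir addr0 addrC.
exists (motion (i + 1) true v); first exact: motion_aut.
by rewrite motion_flag_of // move_cube0 move_unit /move_dir addrK !subr0 addrC.
Qed.

Lemma face_regular : is_regular (@face_rank k).
Proof. exact: regular_of_base base_flagP motion_base_flag. Qed.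

(** Translation by an odd vector. *)
Lemma face_self_dual : self_dual 3 (@face_rank k).
Proof.
pose D := motion 0 false (unit_vec 0).
have rk F : face_rank (D F) = 2 - face_rank F.
  by rewrite motionE rank_move parity_unit.
exists D; split; first by exists (D^-1)%g; [exact: permK | exact: permKV].
apply/andP; split; apply/forallP=> F; last by rewrite /dual_rank rk; apply/eqP; ring.
apply/forallP=> G; apply/eqP.
rewrite leEdual !face_leE !rk incident_sym !motionE incident_move.
by rewrite lerD2l lerN2.
Qed.

Definition base_reflection (i : nat) : {perm face} :=
  match i with
  | 0 => motion 1 true (unit_vec 0 + unit_vec 1)
  | 1 => motion 0 true 0
  | _ => motion 1 true 0
  end.

Lemma base_reflectionP m : (m < 3)%N ->
  is_base_reflection (@face_rank k) base_flag m (base_reflection m).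
Proof.
have p01 : ~~ parity (unit_vec 0 + unit_vec 1 : W).
  by rewrite parityD !parity_unit.
have p0 : ~~ parity (0 : W) by rewrite parity0.
have neqP w y : parity w != parity y -> (w == y) = false.
  by move=> p; apply: contraNF p => /eqP->.
have n01 : (unit_vec 0 == unit_vec 1 :> W) = false.
  by rewrite (inj_eq unit_vec_inj) -[1]add0r neq_succ.
have reflection c r t i x : ~~ parity t ->
    motion c r t @: base_flag = flag_of t i x -> base_flag <> flag_of t i x ->
    (forall F, face_rank F <> m%:Z -> (F \in base_flag) = (F \in flag_of t i x)) ->
    is_base_reflection (@face_rank k) base_flag m (motion c r t).
  move=> pt E neq adj; rewrite /is_base_reflection /rank_adjacent E.
  split=> //; first exact: motion_aut.
  by rewrite -E; apply: aut_flag (motion_aut _ _ pt) base_flagP.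
case: m reflection => [|[|[|//]]] reflection _ /=.
- apply: (reflection _ _ _ 0 (unit_vec 0)) => //.
  + rewrite motion_flag_of // move_cube0 move_unit /move_dir subrr subr0.
    by rewrite subr0 addrCA addxx addr0.
  + move/setP/(_ (Corner 0)); rewrite !corner_in_flag_of eqxx /=.
    rewrite eq_sym addx_eq addr0 eq_sym n01.
    by rewrite neqP // parity0 parity_unit.
  case=> [||w|e] rF; rewrite ?Least_in_flag_of ?Greatest_in_flag_of //.
    have pw: parity w by move: rF => /=; case: parity.
    by rewrite !corner_in_flag_of !(neqP w (_ + _)) ?(neqP w 0) ?pw.
  rewrite !edge_in_flag_of; congr (_ == _); apply/eqP; rewrite eq_edge eqxx.
  rewrite eq_square add0r squareD square_unit add0r.
  by have := square_unit1 (0 : Z); rewrite add0r => ->; rewrite eqxx.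
- apply: (reflection _ _ _ (- 1) (unit_vec 0)) => //.
  + rewrite motion_flag_of // move_cube0 move_unit /move_dir !subr0.
    by rewrite sub0r addr0.
  + move/setP/(_ (Edge (edge_at 0 0))); rewrite !edge_in_flag_of eqxx eq_edge.
    by have := neq_succ (- 1 : Z); rewrite addNr eq_sym => ->.
  by case=> [||w|e] rF;
    rewrite ?Least_in_flag_of ?Greatest_in_flag_of // !corner_in_flag_of.
apply: (reflection _ _ _ 0 (unit_vec 1)) => //.
+ rewrite motion_flag_of // move_cube0 move_unit /move_dir subrr subr0.
  by rewrite subr0 addr0.
+ move/setP/(_ (Corner (unit_vec 0))); rewrite !corner_in_flag_of eqxx orbT n01.
  by rewrite neqP // parity0 parity_unit.
case=> [||w|e] rF; rewrite ?Least_in_flag_of ?Greatest_in_flag_of //.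
  have pw: ~~ parity w by move: rF => /=; case: parity.
  by rewrite !corner_in_flag_of !(neqP w (unit_vec _)) // parity_unit (negPf pw).
by rewrite !edge_in_flag_of.
Qed.

(** The rotation acts on the m edges at the origin as translation by 1 acts on
Z/m. *)
Lemma order_rotation : #[motion 1%R false 0]%g = k.+2.
Proof.
(* For m = 0 the claim is that an idempotent motion is the identity. *)
have rotX m : (motion 1%R false 0 ^+ m)%g = motion m%:R false 0.
  elim: m => [|m IH]; last by rewrite expgSr IH motionM /= move_cube0 mulrS.
  apply: (mulgI (motion 0 false 0)); rewrite expg0 mulg1 motionM /=.
  by rewrite add0r move_cube0.
have natr0 m : (m%:R == 0 :> Z) = (k.+2 %| m)%N.
  by rewrite Zp_nat -val_eqE.
apply/eqP; rewrite eqn_dvd order_dvdn rotX; apply/andP; split.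
  have /eqP -> : k.+2%:R == 0 :> Z by rewrite natr0.
  by rewrite -[motion _ _ _](rotX 0).
have := expg_order (motion 1 false 0); rewrite rotX -natr0.
move/permP/(_ (Edge (edge_at 0 0))); rewrite perm1 motionE move_edge_at => /eqP.
by rewrite eq_Edge eq_edge /move_dir addr0 => /andP[].
Qed.

(** Translation by [unit_vec 0] conjugates reflections 2 and 1 to 0 and 1. *)
Lemma order_base_reflections m : (m < 2)%N ->
  #[base_reflection m * base_reflection m.+1]%g = k.+2.
Proof.
have o12 : #[base_reflection 1 * base_reflection 2]%g = k.+2.
  by rewrite motionM /= subr0 move_cube0 order_rotation.
case: m => [|[|//]] _ //; rewrite -o12.
pose D := motion 0 false (unit_vec 0).
have r0 : base_reflection 0 = (base_reflection 2 ^ D)%g.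
  rewrite conjgE; apply: (canRL (mulKg _)); rewrite !motionM /=.
  by rewrite subr0 add0r move_cube0 move_unit subr0 addrCA addxx addr0.
have r1 : base_reflection 1 = (base_reflection 1 ^ D)%g.
  rewrite conjgE; apply: (canRL (mulKg _)); rewrite !motionM /=.
  by rewrite subr0 add0r move_cube0 move_unit subr0 addr0.
rewrite r0 {1}r1 -conjMg orderJ -(orderJ (_ * _)%g (base_reflection 2)).
by rewrite conjgE !mulgA mulVg mul1g.
Qed.

Lemma face_schlafli : has_schlafli_type 3 (@face_rank k) [:: k.+2; k.+2].
Proof.
have -> : [:: k.+2; k.+2] =
    mkseq (fun m => #[base_reflection m * base_reflection m.+1]%g) 2.
  by congr [:: _; _]; rewrite order_base_reflections.
exact: schlafli_type_of_base face_regular base_flagP base_reflectionP.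
Qed.

End Flags.

Theorem corollary3p6 (p s : nat) (hp : prime p) :
  exists (disp : Order.disp_t) (P : finPOrderType disp) (rk : P -> int),
    [/\ is_polytope 3 rk,
        is_regular rk,
        self_dual 3 rk,
        has_schlafli_type 3 rk [:: 2 ^ s * p; 2 ^ s * p]
      & #|flags P| = 2 ^ (2 ^ s * p + s) * p].
Proof.
have m_gt1 : (1 < 2 ^ s * p)%N.
  by apply: leq_trans (prime_gt1 hp) _; rewrite leq_pmull // expn_gt0.
have [k Ek] : exists k, (2 ^ s * p)%N = k.+2.
  by exists (2 ^ s * p).-2; case: (2 ^ s * p)%N m_gt1 => [|[]].
exists face_display, (face k), (@face_rank k); rewrite expnD -mulnA !Ek.
split.
- exact: face_polytope.
- exact: face_regular.
- exact: face_self_dual.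
- exact: face_schlafli.
exact: card_flags.
Qed.
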